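(* For every integer $t\geq 1$, every graph that does not contain $K^*_{2,t}$ as a minor is $2$-colourable with defect $2t-2$.
   Context: All graphs are finite and simple. $K^*_{s,t}$ denotes the complete join of $K_s$ and the edgeless graph $\overline{K_t}$, i.e. the graph on $s+t$ vertices consisting of a clique of size $s$ together with $t$ pairwise non-adjacent vertices each adjacent to all vertices of the clique. A graph is $k$-colourable with defect $d$ if its vertices can be assigned one of $k$ colours (not necessarily properly) so that each vertex has at most $d$ neighbours of its own colour. *)

(* Defs.v *)
From mathcomp Require Import all_boot.
Set Implicit Arguments.
Unset Strict Implicit.
Unset Printing Implicit Defensive.

Record sgraph := SGraph {
  vertex :> finType;
  adj : rel vertex;
  adj_sym : symmetric adj;
  adj_irr : irreflexive adj }.

Lemma complete_sym n : symmetric [rel i j : 'I_n | i != j].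
Proof. by move=> i j /=; rewrite eq_sym. Qed.

Lemma complete_irr n : irreflexive [rel i j : 'I_n | i != j].
Proof. by move=> i /=; rewrite eqxx. Qed.

Definition complete_graph (n : nat) : sgraph :=
  SGraph (@complete_sym n) (@complete_irr n).

Lemma edgeless_sym n : symmetric [rel i j : 'I_n | false].
Proof. by []. Qed.

Lemma edgeless_irr n : irreflexive [rel i j : 'I_n | false].
Proof. by []. Qed.

Definition edgeless_graph (n : nat) : sgraph :=
  SGraph (@edgeless_sym n) (@edgeless_irr n).

Definition join_adj (G H : sgraph) : rel (G + H)%type := fun x y =>
  match x, y with
  | inl u, inl v => adj u v
  | inr u, inr v => adj u v
  | _, _ => true
  end.

Lemma join_sym G H : symmetric (@join_adj G H).
Proof. by case=> x [] y //=; rewrite adj_sym. Qed.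

Lemma join_irr G H : irreflexive (@join_adj G H).
Proof. by case=> x /=; rewrite adj_irr. Qed.

Definition join_graph (G H : sgraph) : sgraph :=
  SGraph (@join_sym G H) (@join_irr G H).

Definition Kstar (s t : nat) : sgraph :=
  join_graph (complete_graph s) (edgeless_graph t).

Definition connected_set (G : sgraph) (A : {set G}) : Prop :=
  A != set0 /\
  {in A &, forall x y,
     connect [rel u v : G | [&& u \in A, v \in A & adj u v]] x y}.

(** [H] is a minor of [G]: contracting each branch set [B x] to a single vertex,
    and deleting superfluous vertices and edges, turns [G] into a copy of [H]. *)
Definition minor (G H : sgraph) : Prop :=
  exists B : H -> {set G},
    [/\ forall x, connected_set (B x),
        forall x y, x != y -> [disjoint B x & B y]
      & forall x y, adj x y -> exists2 u, u \in B x & exists2 v, v \in B y & adj u v].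

Definition colourable_with_defect (G : sgraph) (k d : nat) : Prop :=
  exists c : G -> 'I_k,
    forall v : G, #|[set w : G | adj v w && (c w == c v)]| <= d.

(* Main.v *)
(** Colour every vertex by the parity of its distance to a root chosen in its
    component. Neighbours of the same colour lie in the same distance layer. If
    a vertex [v] of layer [n + 1] had [t] neighbours in its own layer, then the
    ball of radius [n] around the root (which is connected and dominates the
    layer), [v], and these neighbours would form a [K*_{2,t}] minor. Hence the
    defect is at most [t - 1 <= 2t - 2]. *)
Require Import Defs.
From mathcomp Require Import all_boot.

Set Implicit Arguments.
Unset Strict Implicit.
Unset Printing Implicit Defensive.

Lemma connected_set1 (G : sgraph) (v : G) : connected_set [set v].
Proof.
split; first by apply/set0Pn; exists v; rewrite inE.
by move=> x y /set1P-> /set1P->; apply: connect0.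
Qed.

(** The branch sets are [A] and [[set v]] for the two clique vertices and [t] singletons from [N]
    for the independent ones. Edges inside [N] do no harm, since a minor may drop edges. *)
Lemma Kstar2_minor (t : nat) (G : sgraph) (A : {set G}) (v : G) (N : {set G}) :
    connected_set A -> v \notin A -> (exists2 u, u \in A & adj u v) ->
    {in N, forall w, [/\ adj v w, w \notin A & exists2 u, u \in A & adj u w]} ->
    t <= #|N| ->
  minor G (Kstar 2 t).
Proof.
move=> cA vA [u0 u0A u0v] NP tN.
pose w (j : 'I_t) : G := enum_val (widen_ord tN j).
have wN j : w j \in N by apply: enum_valP.
have w_inj : injective w by move=> i j /enum_val_inj [] /val_inj.
have wv j : v != w j.
  by have [+ _ _] := NP _ (wN j); apply: contraTneq => <-; rewrite adj_irr.
pose B (x : Kstar 2 t) : {set G} := match x with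
  | inl i => if i == ord0 then A else [set v]
  | inr j => [set w j]
  end.
exists B; split=> [[i|j]|[i|i] [j|j] xy|[i|i] [j|j]] //=.
- by case: ifP => _ //; apply: connected_set1.
- exact: connected_set1.
- have {xy} ij : i != j by apply: contraNneq xy => ->.
  case: (eqVneq i ord0) => [i0|i0]; case: (eqVneq j ord0) => [j0|j0].
  + by rewrite i0 j0 eqxx in ij.
  + by rewrite disjoint_sym disjoints1.
  + by rewrite disjoints1.
  (* Both indices lie in ['I_2] and are nonzero, so they coincide, against [ij]. *)
  + by case: i j i0 j0 ij => [[|[|//]] ?] [[|[|//]] ?].
- have [_ wA _] := NP _ (wN j).
  case: ifP => _; first by rewrite disjoint_sym disjoints1.
  by rewrite disjoints1 inE.
- have [_ wA _] := NP _ (wN i).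
  case: ifP => _; first by rewrite disjoints1.
  by rewrite disjoint_sym disjoints1 inE.
- rewrite disjoints1 inE; apply: contraNneq xy => /w_inj ->; exact: eqxx.
- move=> ij; case: (eqVneq i ord0) => [i0|i0]; case: (eqVneq j ord0) => [j0|j0].
  + by rewrite i0 j0 eqxx in ij.
  + by exists u0 => //; exists v; rewrite ?inE.
  + by exists v; rewrite ?inE //; exists u0; rewrite // adj_sym.
  + by case: i j i0 j0 ij => [[|[|//]] ?] [[|[|//]] ?].
- have [vw _ [u uA uw]] := NP _ (wN j) => _.
  case: ifP => _; first by exists u => //; exists (w j); rewrite ?inE.
  by exists v; rewrite ?inE //; exists (w j); rewrite ?inE.
- have [vw _ [u uA uw]] := NP _ (wN i) => _.
  exists (w i); rewrite ?inE //.
  case: ifP => _; first by exists u; rewrite // adj_sym.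
  by exists v; rewrite ?inE // adj_sym.
Qed.

Fixpoint ball (G : sgraph) (r : G) (n : nat) : {set G} :=
  if n is m.+1 then ball r m :|: [set y | [exists x in ball r m, adj x y]]
  else [set r].

Lemma ball_adj (G : sgraph) (r : G) n x y :
  x \in ball r n -> adj x y -> y \in ball r n.+1.
Proof.
by move=> xB xy; rewrite !inE; apply/orP; right; apply/existsP; exists x; rewrite xB.
Qed.

Lemma sub_ball (G : sgraph) (r : G) m n : m <= n -> ball r m \subset ball r n.
Proof.
elim: n => [|n IHn]; first by rewrite leqn0 => /eqP->.
rewrite leq_eqVlt => /predU1P[-> //|/IHn sB].
exact: subset_trans sB (subsetUl _ _).
Qed.

Lemma connect_ball (G : sgraph) (r x : G) :
  connect (@adj G) r x -> exists n, x \in ball r n.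
Proof.
move=> /connectP[p]; elim/last_ind: p x => [|p y IHp] x.
  by move=> _ ->; exists 0; rewrite inE.
rewrite rcons_path last_rcons => /andP[rp py] ->.
by have [n xn] := IHp _ rp erefl; exists n.+1; apply: ball_adj xn py.
Qed.

(** By induction on the radius, every vertex of the ball is reached from the centre without leaving
    the ball; by symmetry any two vertices are then linked through the centre. *)
Lemma ball_connected (G : sgraph) (r : G) n : connected_set (ball r n).
Proof.
have rB m : r \in ball r m by rewrite (subsetP (sub_ball r (leq0n m))) ?inE.
split; first by apply/set0Pn; exists r.
pose e m := [rel u v : G | [&& u \in ball r m, v \in ball r m & adj u v]].
suff rx m x : x \in ball r m -> connect (e m) r x.
  have sym_e : symmetric (e n).
    by move=> u v /=; rewrite adj_sym andbCA.
  move=> x y xB yB; apply: connect_trans (rx n y yB).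
  by rewrite (sym_connect_sym sym_e); apply: rx.
elim: m x => [|m IHm] x; first by rewrite inE => /eqP->.
have e_mono y : y \in ball r m -> connect (e m.+1) r y.
  move/IHm; apply: connect_sub => a b /and3P[aB bB ab]; apply: connect1.
  by rewrite /= ab !(subsetP (sub_ball r (leqnSn m))).
move=> xB; move: (xB); rewrite {1}[ball r m.+1]/= in_setU.
case/orP=> [|]; first exact: e_mono.
rewrite inE => /existsP[y /andP[yB yx]].
apply: connect_trans (e_mono y yB) (connect1 _).
by rewrite /= in (xB) *; rewrite yx xB (subsetP (sub_ball r (leqnSn m))).
Qed.

Lemma ball_root (G : sgraph) (x : G) : exists n, x \in ball (root (@adj G) x) n.
Proof.
apply: connect_ball; rewrite (sym_connect_sym (@adj_sym G)).
exact: connect_root.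
Qed.

(** This is the distance to the representative that [root] picks in the component of [x], so it is
    defined on disconnected graphs too. *)
Definition depth (G : sgraph) (x : G) : nat := ex_minn (ball_root x).

Lemma depth_leq (G : sgraph) (x : G) n :
  (depth x <= n) = (x \in ball (root (@adj G) x) n).
Proof.
rewrite /depth; case: ex_minnP => m xm min_m.
apply/idP/idP => [mn|]; last exact: min_m.
exact: subsetP (sub_ball _ mn) _ xm.
Qed.

Lemma adj_root (G : sgraph) (x y : G) : adj x y -> root (@adj G) x = root (@adj G) y.
Proof.
by move=> xy; apply/(rootP (sym_connect_sym (@adj_sym G)))/connect1.
Qed.

Lemma adj_depth (G : sgraph) (x y : G) : adj x y -> depth y <= (depth x).+1.
Proof.
move=> xy; rewrite depth_leq; apply: ball_adj (xy).
by rewrite -(adj_root xy) -depth_leq.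
Qed.

(** Depths of neighbours differ by at most one, and a difference of exactly one flips the parity. *)
Lemma same_parity_depth (G : sgraph) (x y : G) :
  adj x y -> odd (depth x) = odd (depth y) -> depth x = depth y.
Proof.
move=> xy; have yx : adj y x by rewrite adj_sym.
case: (ltngtP (depth x) (depth y)) => // lt_d.
- have -> : depth y = (depth x).+1 by apply/eqP; rewrite eqn_leq adj_depth.
  by move=> /=; case: (odd _).
- have -> : depth x = (depth y).+1 by apply/eqP; rewrite eqn_leq adj_depth.
  by move=> /=; case: (odd _).
Qed.

Lemma depth0 (G : sgraph) (x : G) : depth x = 0 -> x = root (@adj G) x.
Proof. by move=> x0; apply/set1P; rewrite -[[set _]]/(ball _ 0) -depth_leq x0. Qed.

(** These are the conditions that [Kstar2_minor] puts on [v] and on the vertices of [N], with the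
    ball of radius [n] as [A]. *)
Lemma depthS (G : sgraph) (x : G) n : depth x = n.+1 ->
  x \notin ball (root (@adj G) x) n /\ exists2 u, u \in ball (root (@adj G) x) n & adj u x.
Proof.
move=> xn; have xB : x \notin ball (root (@adj G) x) n by rewrite -depth_leq xn ltnn.
split=> //; have : x \in ball (root (@adj G) x) n.+1 by rewrite -depth_leq xn.
by rewrite in_setU (negPf xB) inE => /existsP[u /andP[uB ux]]; exists u.
Qed.

Lemma layer_degree (t : nat) (G : sgraph) (v : G) : 0 < t ->
  ~ minor G (Kstar 2 t) -> #|[set w | adj v w & depth w == depth v]| < t.
Proof.
move=> t_gt0 noK; case dv: (depth v) => [|n].
  (* Layer 0 of a component is its root alone: a neighbour [w] of depth 0 would equal [v], making
     [v] adjacent to itself. *)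
  rewrite (_ : [set w | _] = set0) ?cards0 //; apply/setP=> w; rewrite !inE.
  apply/negP=> /andP[vw /eqP/depth0 w0]; move: (vw).
  by rewrite w0 -(adj_root vw) -(depth0 dv) adj_irr.
rewrite ltnNge; apply/negP => tN; apply: noK.
have [vB vU] := depthS dv.
apply: Kstar2_minor (ball_connected _ _) vB vU _ tN => w.
rewrite inE => /andP[vw /eqP/depthS[]].
(* Being adjacent, [w] and [v] share a root, so one ball serves for both. *)
by rewrite -(adj_root vw).
Qed.

Theorem theorem15 (t : nat) (ht : 1 <= t) (G : sgraph)
    (hG : ~ minor G (Kstar 2 t)) :
  colourable_with_defect G 2 (2 * t - 2).
Proof.
exists (fun x => inord (odd (depth x))) => v.
apply: (@leq_trans t.-1).
  (* The bound [2 * t - 2] is twice [t.-1]. *)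
  2: by case: t ht {hG} => // t _; rewrite mulnS addKn leq_pmull.
rewrite -ltnS prednK //; apply: leq_ltn_trans (layer_degree v ht hG).
apply/subset_leq_card/subsetP => w; rewrite !inE => /andP[vw /eqP cE].
rewrite vw /=; apply/eqP/esym/same_parity_depth => //.
(* Parities are below 2, so [inord] does not fall back on its default value and equal colours mean
   equal parities. *)
have odd2 x : odd x < 2 by case: odd.
by move/(congr1 val): cE; rewrite /= !inordK ?odd2 //; do 2!case: odd.
Qed.
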